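(* There exist universal numerical constants $c>0$ and $\hat c>0$ such that the following holds. Let $M\in\mathbb{R}^{n\times n}$ be a positive definite matrix, let $U_0\in\mathbb{R}^{n\times n}$ be a positive definite matrix, and define $$\alpha = \left(\frac{\max\left(\|U_0\|_2,\sqrt{\|M\|_2}\right)}{\min\left(\sigma_{\min}(U_0),\sqrt{\sigma_{\min}(M)}\right)}\right)^3,\qquad \beta=\min\left(\sigma_{\min}(U_0),\sqrt{\sigma_{\min}(M)}\right).$$ Let the step size satisfy $0<\eta<\frac{c}{\alpha\beta^2}$, let $T\ge 1$, and let $U_{t+1}=U_t-\eta(U_t^2-M)U_t-\eta U_t(U_t^2-M)$ for $t=0,\dots,T-1$. Then for every $t\in\{0,1,\dots,T-1\}$, $U_t$ is a positive definite matrix and $$\|M-U_t^2\|_F\le \exp\left(-\hat c\,\eta\,\beta^2 t\right)\|M-U_0^2\|_F.$$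
   Context: Positive definite means symmetric positive definite (real). $\|\cdot\|_2$ is the operator (spectral) norm, $\|\cdot\|_F$ the Frobenius norm, and $\sigma_{\min}(\cdot)$ the smallest singular value. Universal constants do not depend on $n$, $M$, $U_0$, $\eta$, $T$. *)

(* Defs.v *)
From mathcomp Require Import all_boot all_order all_algebra.
From mathcomp Require Import classical_sets reals.

Set Implicit Arguments.
Unset Strict Implicit.
Unset Printing Implicit Defensive.

Import Order.TTheory GRing.Theory Num.Theory.
Local Open Scope ring_scope.
Local Open Scope classical_set_scope.

Definition posdef (R : realType) (n : nat) (A : 'M[R]_n) : Prop :=
  A \is symmetricmx /\
  forall x : 'cV[R]_n, x != 0 -> 0 < (x^T *m A *m x) 0 0.

(* The norm `|_| that MathComp-Analysis puts on matrices is the max norm,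
   hence the explicit Euclidean, Frobenius and operator norms below. *)
Definition norm2 (R : realType) (n : nat) (x : 'cV[R]_n) : R :=
  Num.sqrt (\sum_i x i 0 ^+ 2).

Definition normF (R : realType) (m n : nat) (A : 'M[R]_(m, n)) : R :=
  Num.sqrt (\sum_i \sum_j A i j ^+ 2).

Definition opnorm2 (R : realType) (m n : nat) (A : 'M[R]_(m, n)) : R :=
  sup [set norm2 (A *m x) | x in [set x : 'cV[R]_n | norm2 x <= 1]].

(* For square A: the square roots of the eigenvalues of A^T A. *)
Definition singular_values (R : realType) (n : nat) (A : 'M[R]_n) : set R :=
  [set s | 0 <= s /\ eigenvalue (A^T *m A) (s ^+ 2)].

(* This set is finite, and nonempty when n > 0, so that inf is a minimum;
   for n = 0 the value is inf set0 = 0. *)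
Definition sigma_min (R : realType) (n : nat) (A : 'M[R]_n) : R :=
  inf (singular_values A).

(* Main.v *)
(** In terms of [E = U^2 - M] and [F = E U + U E], one step is [U' = U - eta F], and
[U'^2 - M = E - eta (U F + F U) + eta^2 F^2].  Let [b] and [g] be the min and the
max in the theorem; the step size condition says [eta g^3 < c b].

The bounds [b/2 <= U <= 2g] (as quadratic forms) are invariant although [U] and [M]
need not commute.  For the lower one write [U = b/2 + P]; then
[U M + M U = b M + P M + M P], and completing the square against a fraction of [P]
bounds the indefinite part from below by a multiple of [- eta g^3 M], which the term
[b M >= b^3] absorbs.  The upper bound is similar, with [Q = 2g - U].

Given these bounds, [<E, U F + F U> = |F|^2 >= b^2 |E|^2] in the Frobenius product,
and the terms of order [eta^2] are at most [eta |F|^2], so that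
[|U'^2 - M|^2 <= (1 - eta b^2) |E|^2]. *)

Require Import Defs.
From mathcomp Require Import all_boot all_order all_algebra.
From mathcomp Require Import classical_sets reals sequences exp.
From mathcomp Require Import ring lra.

Set Implicit Arguments.
Unset Strict Implicit.
Unset Printing Implicit Defensive.

Import Order.TTheory GRing.Theory Num.Theory.
Local Open Scope ring_scope.

(** * The Frobenius inner product; on column vectors it is the Euclidean one *)

Section FrobeniusProduct.
Variable R : realType.

Definition frob m n (A B : 'M[R]_(m, n)) : R := \tr (A^T *m B).

Lemma frobE m n (A B : 'M[R]_(m, n)) :
  frob A B = \sum_j \sum_i A i j * B i j.
Proof.
rewrite /frob /mxtrace; apply: eq_bigr => j _.
by rewrite mxE; apply: eq_bigr => i _; rewrite mxE.
Qed.

Lemma frobC m n (A B : 'M[R]_(m, n)) : frob A B = frob B A.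
Proof. by rewrite /frob -mxtrace_tr trmx_mul trmxK. Qed.

Lemma frobDr m n (A B C : 'M[R]_(m, n)) :
  frob A (B + C) = frob A B + frob A C.
Proof. by rewrite /frob mulmxDr mxtraceD. Qed.

Lemma frobZr m n a (A B : 'M[R]_(m, n)) : frob A (a *: B) = a * frob A B.
Proof. by rewrite /frob -scalemxAr mxtraceZ. Qed.

Lemma frobNr m n (A B : 'M[R]_(m, n)) : frob A (- B) = - frob A B.
Proof. by rewrite /frob mulmxN raddfN. Qed.

Lemma frobDl m n (A B C : 'M[R]_(m, n)) :
  frob (B + C) A = frob B A + frob C A.
Proof. by rewrite ![frob _ A]frobC frobDr. Qed.

Lemma frobZl m n a (A B : 'M[R]_(m, n)) : frob (a *: B) A = a * frob B A.
Proof. by rewrite ![frob _ A]frobC frobZr. Qed.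

Lemma frobNl m n (A B : 'M[R]_(m, n)) : frob (- B) A = - frob B A.
Proof. by rewrite ![frob _ A]frobC frobNr. Qed.

Definition frob_lin := (frobDl, frobDr, frobNl, frobNr, frobZl, frobZr).

Lemma frob_mull m n (A : 'M[R]_m) (X Y : 'M[R]_(m, n)) :
  frob (A *m X) Y = frob X (A^T *m Y).
Proof. by rewrite /frob trmx_mul mulmxA. Qed.

Lemma frob_mulr m n (A : 'M[R]_n) (X Y : 'M[R]_(m, n)) :
  frob (X *m A) Y = frob X (Y *m A^T).
Proof. by rewrite /frob trmx_mul -mulmxA mxtrace_mulC mulmxA. Qed.

Lemma frob_tr m n (X Y : 'M[R]_(m, n)) : frob X^T Y^T = frob X Y.
Proof. by rewrite /frob trmxK mxtrace_mulC -mxtrace_tr trmx_mul trmxK. Qed.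

Lemma frob_ge0 m n (A : 'M[R]_(m, n)) : 0 <= frob A A.
Proof.
by rewrite frobE; apply: sumr_ge0 => j _; apply: sumr_ge0 => i _; exact: sqr_ge0.
Qed.

Lemma frob_gt0 m n (A : 'M[R]_(m, n)) : A != 0 -> 0 < frob A A.
Proof.
move=> A0; rewrite lt_neqAle frob_ge0 andbT eq_sym; apply: contra A0 => /eqP.
rewrite frobE => A0; apply/eqP/matrixP => i j; rewrite mxE; apply/eqP.
have s0 k : 0 <= \sum_i A i k * A i k by apply: sumr_ge0 => l _; exact: sqr_ge0.
move/psumr_eq0P : (A0) => /(_ (fun k _ => s0 k)) /(_ j isT) /psumr_eq0P.
by move=> /(_ (fun k _ => sqr_ge0 _)) /(_ i isT) /eqP; rewrite mulf_eq0 orbb.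
Qed.

Lemma frob_col m n (A B : 'M[R]_(m, n)) :
  frob A B = \sum_j frob (col j A) (col j B).
Proof.
rewrite frobE; apply: eq_bigr => j _; rewrite frobE big_ord1.
by apply: eq_bigr => i _; rewrite !mxE.
Qed.

Lemma normFE m n (A : 'M[R]_(m, n)) : normF A = Num.sqrt (frob A A).
Proof. by rewrite frobE exchange_big. Qed.

Lemma norm2E n (x : 'cV[R]_n) : norm2 x = Num.sqrt (frob x x).
Proof. by rewrite frobE big_ord1. Qed.

Lemma frob_quad n (A : 'M[R]_n) (x : 'cV[R]_n) :
  (x^T *m A *m x) 0 0 = frob x (A *m x).
Proof. by rewrite /frob mulmxA trace_mx11. Qed.

Lemma frob_sqrD m n (A B : 'M[R]_(m, n)) :
  frob (A + B) (A + B) = frob A A + 2 * frob A B + frob B B.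
Proof. by rewrite !frob_lin (frobC B A); ring. Qed.

Lemma frob_le2 m n (A B : 'M[R]_(m, n)) :
  frob (A + B) (A + B) <= 2 * frob A A + 2 * frob B B.
Proof.
have := frob_ge0 (A - B); rewrite !frob_lin (frobC B A); lra.
Qed.

(** Nonnegativity of the product of [<B,B> A - <A,B> B] with itself, divided by [<B,B>]. *)
Lemma frob_CS m n (A B : 'M[R]_(m, n)) :
  frob A B ^+ 2 <= frob A A * frob B B.
Proof.
have [->|B0] := eqVneq B 0.
  by rewrite -[0 in X in X ^+ 2](scale0r 0) -[0 in X in _ * X](scale0r 0) !frob_lin; lra.
have Bp := frob_gt0 B0.
have := frob_ge0 (frob B B *: A - frob A B *: B).
rewrite !frob_lin (frobC B A).
set a := frob A A; set b := frob B B; set c := frob A B => h.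
have : 0 <= b * (a * b - c ^+ 2) by nra.
by rewrite pmulr_rge0 // subr_ge0.
Qed.

End FrobeniusProduct.

(** * Bounds on quadratic forms and on squared operator norms *)

Section QuadraticForms.
Variable R : realType.
Variable n : nat.
Implicit Types (A B U M E P : 'M[R]_n) (a b : R).

(** Testing on matrices [X] instead of vectors lets the bounds apply directly to residuals in the
    Frobenius product; working column by column shows that vectors suffice. *)
Definition form_ge A a :=
  forall k (X : 'M[R]_(n, k)), a * frob X X <= frob X (A *m X).

Definition form_le A a :=
  forall k (X : 'M[R]_(n, k)), frob X (A *m X) <= a * frob X X.

(** Here [a] bounds the square of the operator norm, which avoids roots. *)
Definition op_le A a :=
  forall k (X : 'M[R]_(n, k)), frob (A *m X) (A *m X) <= a * frob X X.

Lemma form_ge_col A a :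
  (forall x : 'cV[R]_n, a * frob x x <= frob x (A *m x)) -> form_ge A a.
Proof.
move=> h k X; rewrite frob_col (frob_col _ (A *m X)) mulr_sumr.
by apply: ler_sum => j _; rewrite !colE -mulmxA -!colE h.
Qed.

Lemma op_le_col A a :
  (forall x : 'cV[R]_n, frob (A *m x) (A *m x) <= a * frob x x) -> op_le A a.
Proof.
move=> h k X; rewrite frob_col (frob_col X) mulr_sumr.
by apply: ler_sum => j _; rewrite !colE -mulmxA -!colE h.
Qed.

Lemma form_ge_weaken A a a' : a' <= a -> form_ge A a -> form_ge A a'.
Proof.
by move=> aa' h k X; apply: le_trans (h k X); rewrite ler_wpM2r ?frob_ge0.
Qed.

Lemma op_le_form_le A a : 0 <= a -> op_le A (a ^+ 2) -> form_le A a.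
Proof.
move=> a0 h k X; have X0 := frob_ge0 X.
rewrite -[leRHS]ger0_norm ?mulr_ge0// (le_trans (ler_norm _))//.
rewrite -ler_sqr ?nnegrE // !real_normK ?num_real //.
apply: le_trans (frob_CS _ _) _; rewrite exprMn expr2 mulrC -expr2 expr2.
by have := h k X; nra.
Qed.

Lemma frob_sym A : A^T = A -> forall k (X Y : 'M[R]_(n, k)),
  frob (A *m X) Y = frob X (A *m Y).
Proof. by move=> As k X Y; rewrite frob_mull As. Qed.

(* Nonnegativity of the form of A at X - a^-1 A X. *)
Lemma psd_sqr_le A a k (X : 'M[R]_(n, k)) : A^T = A -> 0 < a ->
  form_ge A 0 -> form_le A a ->
  frob (A *m X) (A *m X) <= a * frob X (A *m X).
Proof.
move=> As a0 Age Ale.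
have := Age _ (a *: X - A *m X); have := Ale _ (A *m X).
rewrite mul0r mulmxBr -scalemxAr !frob_lin.
rewrite (frob_sym As X (A *m X)) -(frob_sym As X (A *m X)).
set x := frob X _; set y := frob (A *m X) (A *m X); set z := frob _ (A *m (A *m X)).
move=> h1 h2; have : 0 <= a * (a * x - y) by nra.
by rewrite pmulr_rge0 // subr_ge0.
Qed.

Lemma psd_op_le A a : A^T = A -> 0 < a ->
  form_ge A 0 -> form_le A a -> op_le A (a ^+ 2).
Proof.
move=> As a0 Age Ale k X; apply: le_trans (psd_sqr_le X As a0 Age Ale) _.
by rewrite expr2 -mulrA ler_pM2l.
Qed.

End QuadraticForms.

(** * One gradient step: invariance of the bounds on [U] and contraction of the residual *)

Section GradientStep.
Variables (R : realType) (n : nat) (M U : 'M[R]_n) (eta b g : R).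

Let E := U *m U - M.
Let F := E *m U + U *m E.

Definition gd_step := U - eta *: (E *m U) - eta *: (U *m E).

Hypotheses (Ms : M^T = M) (Us : U^T = U).
Hypotheses (eta0 : 0 < eta) (b0 : 0 < b) (bg : b <= g).
Hypotheses (eta_g2 : 2000 * (eta * g ^+ 2) <= 1).
Hypotheses (eta_g3 : 2000 * (eta * g ^+ 3) <= b).
(** [Mop] and [Msqr] both express [M <= g^2]: as a squared operator norm, whence the exponent 4, and
    as [M^2 <= g^2 M]. *)
Hypotheses (Mge : form_ge M (b ^+ 2)) (Mop : op_le M (g ^+ 4)).
Hypotheses (Msqr : forall k (X : 'M[R]_(n, k)),
  frob (M *m X) (M *m X) <= g ^+ 2 * frob X (M *m X)).
Hypotheses (Uge : form_ge U (b / 2)) (Ule : form_le U (2 * g)).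

Let g0 : 0 < g. Proof. exact: lt_le_trans b0 bg. Qed.

Lemma gd_step_sym : gd_step^T = gd_step.
Proof.
have Es : E^T = E by rewrite /E linearB /= trmx_mul Us Ms.
rewrite /gd_step; clearbody E.
by rewrite 2!linearB !linearZ /= !trmx_mul Us Es addrAC.
Qed.

(** By symmetry the contributions of [U M] and [M U] coincide, so noncommutativity leaves the single
    mixed term [<U X, M X>]. *)
Lemma form_gd_step k (X : 'M[R]_(n, k)) :
  frob X (gd_step *m X) = frob X (U *m X)
    - 2 * eta * frob (U *m X) (U *m (U *m X))
    + 2 * eta * frob (U *m X) (M *m X).
Proof.
rewrite /gd_step /E !(mulmxBl, mulmxBr) -!scalemxAl !(mulmxBl, mulmxBr) -!mulmxA.
rewrite !frob_lin.
rewrite -!(frob_sym Us X) -(frob_sym Ms X) (frobC (M *m X)).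
ring.
Qed.

(* Completing the square: the form of P at X + 2 eta M X is nonnegative. *)
Lemma cross_term_ge (P : 'M[R]_n) k (X : 'M[R]_(n, k)) :
  P^T = P -> form_ge P 0 -> form_le P (2 * g) ->
  - (1 / 2 * frob X (P *m X) + 4 * eta ^+ 2 * g ^+ 3 * frob X (M *m X))
    <= 2 * eta * frob (P *m X) (M *m X).
Proof.
move=> Ps Pge Ple.
have := Pge _ (X + (2 * eta) *: (M *m X)); have := Ple _ (M *m X).
have := Msqr X.
rewrite mul0r mulmxDr -scalemxAr !frob_lin.
rewrite -(frob_sym Ps X (M *m X)) (frobC (M *m X) (P *m X)).
set z := frob (M *m X) (M *m X); set p := frob X (P *m X).
set q := frob (M *m X) (P *m _); set r := frob (P *m X) _; set m := frob X _.
move=> h1 h2 h3.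
(* The cost of completing the square: [P <= 2g] and [M^2 <= g^2 M] reduce it to the form of [M]. *)
have h4 : eta ^+ 2 * q <= eta ^+ 2 * (2 * g ^+ 3 * m).
  apply: ler_wpM2l; first exact: sqr_ge0.
  apply: le_trans h2 _; have : 2 * g * z <= 2 * g * (g ^+ 2 * m).
    by rewrite ler_pM2l // mulr_gt0.
  lra.
nra.
Qed.

(** Half of [<X, P X>] absorbs the cubic terms containing [P], the other half the cross term. What
    remains, [eta b^3 / 4] times [<X, X>] and [4 eta^2 g^3 <X, M X>], is paid for by
    [eta b <X, M X>]. *)
Lemma gd_step_ge : form_ge gd_step (b / 2).
Proof.
move=> k X; rewrite form_gd_step.
set P := U - (b / 2)%:M.
have Ps : P^T = P by rewrite /P linearB /= Us tr_scalar_mx.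
have UE Y : U *m Y = (b / 2) *: Y + P *m Y :> 'M_(n, k).
  by rewrite /P mulmxBl mul_scalar_mx addrC subrK.
have Pge : form_ge P 0.
  move=> l Y; rewrite mul0r /P mulmxBl mul_scalar_mx !frob_lin subr_ge0; exact: Uge.
have Ple : form_le P (2 * g).
  move=> l Y; rewrite /P mulmxBl mul_scalar_mx !frob_lin.
  have := Ule Y; have := mulr_ge0 (ltW b0) (frob_ge0 Y); lra.
have x0 := frob_ge0 X.
have hc := cross_term_ge X Ps Pge Ple.
have g20 : 0 < 2 * g by rewrite mulr_gt0.
have hP1 := psd_sqr_le X Ps g20 Pge Ple.
have hP2 := Ple _ (P *m X).
have hP0 := Pge _ X.
have hm := Mge X.
rewrite !UE mulmxDr -!scalemxAr !frob_lin.
rewrite (frob_sym Ps X (P *m X)) in hP1 *.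
rewrite -(frob_sym Ps X (P *m X)) (frobC (P *m X) X) in hP1 *.
rewrite mul0r in hP0.
move: hc hP0 hP1 hP2 hm x0 (frob_ge0 (P *m X)).
set x := frob X X; set p := frob X (P *m X); set p2 := frob (P *m X) (P *m X).
set p3 := frob (P *m X) (P *m (P *m X)); set m := frob X (M *m X).
set r := frob (P *m X) (M *m X).
move=> hc hP0 hP1 hP2 hm x0 hp2.
(* These are the terms of [(b/2 + P)^3] containing [P]; [b <= g] and [P <= 2g] give
   [3/4 + 3 + 4 < 8]. *)
have cub : (b / 2) ^+ 2 * p * 3 + (b / 2) * p2 * 3 + p3 <= 8 * g ^+ 2 * p.
  have i1 : b ^+ 2 * p <= g ^+ 2 * p.
    apply: ler_wpM2r => //; rewrite ler_pXn2r ?nnegrE ?(ltW b0) ?(ltW g0) //.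
  have i2 : b * p2 <= g * (2 * g * p) by rewrite ler_pM // ltW.
  have i3 : p3 <= 2 * g * (2 * g * p) by apply: le_trans hP2 _; rewrite ler_pM2l.
  nra.
have cub' : 2 * eta * ((b / 2) ^+ 2 * p * 3 + (b / 2) * p2 * 3 + p3) <= 1 / 2 * p.
  have : eta * ((b / 2) ^+ 2 * p * 3 + (b / 2) * p2 * 3 + p3) <= eta * (8 * g ^+ 2 * p).
    by rewrite ler_pM2l.
  have : 2000 * (eta * g ^+ 2) * p <= 1 * p by apply: ler_wpM2r.
  nra.
have hm0 : 0 <= eta * (m - b ^+ 2 * x) by rewrite mulr_ge0 ?subr_ge0 // ltW.
have m0 : 0 <= eta * m.
  by apply: mulr_ge0; [exact: ltW | apply: le_trans hm; rewrite mulr_ge0 ?sqr_ge0].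
(* The loss [4 eta^2 g^3 m] is thus at most a 500th of the gain [eta b m]. *)
have hq : 2000 * (eta * g ^+ 3) * (eta * m) <= b * (eta * m) by apply: ler_wpM2r.
have hb : 0 <= b * (eta * (m - b ^+ 2 * x)) by rewrite mulr_ge0 // ltW.
have hbm : 0 <= b * (eta * m) by rewrite mulr_ge0 // ltW.
nra.
Qed.

(** With [U = 2g - Q], the cubic term gives [-16 eta g^3 <X, X>], while [M <= g^2] gives back at
    most [4 eta g^3 <X, X>]. This surplus and [-<X, Q X>] absorb the rest. *)
Lemma gd_step_le : form_le gd_step (2 * g).
Proof.
move=> k X; rewrite form_gd_step.
set Q := (2 * g)%:M - U.
have Qs : Q^T = Q by rewrite /Q linearB /= Us tr_scalar_mx.
have UE Y : U *m Y = (2 * g) *: Y - Q *m Y :> 'M_(n, k).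
  by rewrite /Q mulmxBl mul_scalar_mx opprB addrC subrK.
have Qge : form_ge Q 0.
  move=> l Y; rewrite mul0r /Q mulmxBl mul_scalar_mx !frob_lin subr_ge0; exact: Ule.
have Qle : form_le Q (2 * g).
  move=> l Y; rewrite /Q mulmxBl mul_scalar_mx !frob_lin.
  have := Uge Y; have := mulr_ge0 (ltW b0) (frob_ge0 Y); lra.
have x0 := frob_ge0 X.
have hc := cross_term_ge X Qs Qge Qle.
have hQ2 := Qle _ (Q *m X).
have hQ0 := Qge _ X.
have hm : frob X (M *m X) <= g ^+ 2 * frob X X.
  by apply: op_le_form_le; rewrite ?sqr_ge0 // -exprM.
have hm1 := Mge X.
rewrite !UE mulmxBr -!scalemxAr !frob_lin.
rewrite (frob_sym Qs X (Q *m X)) -(frob_sym Qs X (Q *m X)) (frobC (Q *m X) X).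
rewrite mul0r in hQ0.
move: hc hQ0 hQ2 hm hm1 x0 (frob_ge0 (Q *m X)).
set x := frob X X; set p := frob X (Q *m X); set p2 := frob (Q *m X) (Q *m X).
set p3 := frob (Q *m X) (Q *m (Q *m X)); set m := frob X (M *m X).
set r := frob (Q *m X) (M *m X).
move=> hc hQ0 hQ2 hm hm1 x0 hp2.
(* In [(2g - Q)^3] the quadratic term in [Q] dominates the cubic one, since [Q <= 2g]. *)
have cub : 0 <= eta * (6 * g * p2 - p3).
  by rewrite mulr_ge0 ?(ltW eta0) //; have := mulr_ge0 (ltW g0) hp2; lra.
have hp : 2000 * (eta * g ^+ 2) * p <= 1 * p by apply: ler_wpM2r.
have m0 : 0 <= m by apply: le_trans hm1; rewrite mulr_ge0 ?sqr_ge0.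
have em0 : 0 <= eta * (g * m) by rewrite !mulr_ge0 // ltW.
have hq : 2000 * (eta * g ^+ 2) * (eta * (g * m)) <= 1 * (eta * (g * m)) by apply: ler_wpM2r.
have hx : eta * g * m <= eta * g * (g ^+ 2 * x).
  by apply: ler_wpM2l => //; rewrite mulr_ge0 // ltW.
have hx0 : 0 <= eta * g * (g ^+ 2 * x) by rewrite !mulr_ge0 ?sqr_ge0 // ltW.
nra.
Qed.

Let Uop : op_le U ((2 * g) ^+ 2).
Proof.
apply: psd_op_le => //; first by rewrite mulr_gt0.
by apply: form_ge_weaken Uge; rewrite divr_ge0 // ltW.
Qed.

Let Es : E^T = E. Proof. by rewrite /E linearB /= trmx_mul Us Ms. Qed.

Let Fs : F^T = F.
Proof. by rewrite /F; clearbody E; rewrite linearD /= !trmx_mul Us Es addrC. Qed.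

(** Only an upper bound: [M >= 0] gives [E <= U^2 <= 4 g^2]. *)
Let Ele : form_le E (4 * g ^+ 2).
Proof.
move=> k X; rewrite /E mulmxBl -mulmxA !frob_lin -(frob_sym Us X).
have := Uop X; have := form_ge_weaken (sqr_ge0 b) Mge X.
rewrite mul0r; lra.
Qed.

(** [34 = 2 (16 + 1)], from [U^2] and [M]; likewise [544 = 2 (136 + 136)] in [Fop], with
    [136 = 4 . 34]. *)
Let Eop : op_le E (34 * g ^+ 4).
Proof.
move=> k X; rewrite /E mulmxBl -mulmxA.
apply: le_trans (frob_le2 _ _) _; rewrite !frob_lin opprK.
have := Uop X; have := Uop (U *m X); have := Mop X.
set x := frob X X; set y := frob (U *m X) (U *m X) => h1 h2 h3.
have : (2 * g) ^+ 2 * y <= (2 * g) ^+ 2 * ((2 * g) ^+ 2 * x).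
  by rewrite ler_wpM2l ?sqr_ge0.
lra.
Qed.

Let Fop : op_le F (544 * g ^+ 6).
Proof.
move=> k X; rewrite /F mulmxDl -!mulmxA.
apply: le_trans (frob_le2 _ _) _.
have h1 := Uop X; have h2 := Eop X.
have h3 := Eop (U *m X); have h4 := Uop (E *m X).
have h5 : 34 * g ^+ 4 * frob (U *m X) (U *m X)
    <= 34 * g ^+ 4 * ((2 * g) ^+ 2 * frob X X).
  by rewrite ler_wpM2l // mulr_ge0 // exprn_ge0 // ltW.
have h6 : (2 * g) ^+ 2 * frob (E *m X) (E *m X)
    <= (2 * g) ^+ 2 * (34 * g ^+ 4 * frob X X).
  by rewrite ler_wpM2l ?sqr_ge0.
lra.
Qed.

Lemma residual_gd_step :
  gd_step *m gd_step - M
    = E + (eta ^+ 2 *: (F *m F) - eta *: (U *m F + F *m U)).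
Proof.
have -> : gd_step = U - eta *: F by rewrite /gd_step /F scalerDr opprD addrA.
rewrite /E mulmxBl !mulmxBr -!scalemxAl -!scalemxAr scalerA -expr2.
rewrite scalerDr.
move: (U *m U) (eta *: (U *m F)) (eta *: (F *m U)) (eta ^+ 2 *: (F *m F)).
by move=> A B C D; apply/matrixP => i j; rewrite !mxE; ring.
Qed.

(** With [U = b/2 + P] one has [F = b E + G] for [G = E P + P E], and [<E, G> = 2 <E, P E> >= 0], so
    expanding [<F, F>] only adds nonnegative terms. *)
Lemma frob_anticomm_ge : b ^+ 2 * frob E E <= frob F F.
Proof.
set P := U - (b / 2)%:M.
have Ps : P^T = P by rewrite /P linearB /= Us tr_scalar_mx.
have Pge : form_ge P 0.
  move=> l Y; rewrite mul0r /P mulmxBl mul_scalar_mx !frob_lin subr_ge0; exact: Uge.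
have -> : F = b *: E + (E *m P + P *m E).
  rewrite /F /P; clearbody E; rewrite mulmxBl mulmxBr mul_scalar_mx mul_mx_scalar.
  by apply/matrixP => i j; rewrite !mxE; field.
have EP : frob E (E *m P) = frob E (P *m E) by rewrite -frob_tr trmx_mul Es Ps.
have := Pge _ E; have := frob_ge0 (E *m P + P *m E).
set G := E *m P + P *m E => h1 h2.
have h3 : 0 <= b * frob E G.
  by rewrite mulr_ge0 ?(ltW b0) // /G frobDr EP; move: h2; lra.
clearbody G E; rewrite !frob_lin (frobC G E); lra.
Qed.

(** The first-order term is [-2 eta <F, F>]. The others add up to at most [(8 + 32 + 1088) / 2000]
    times [eta <F, F>], which leaves [-eta <F, F>] for the contraction. *)
Lemma residual_gd_step_le :
  frob (gd_step *m gd_step - M) (gd_step *m gd_step - M)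
    <= (1 - eta * b ^+ 2) * frob E E.
Proof.
rewrite residual_gd_step.
set G := U *m F + F *m U; set H := F *m F.
have hEG : frob E G = frob F F.
  rewrite /G frobDr -(frob_sym Us) -[U in F *m U]Us -frob_mulr.
  by rewrite -frobDl addrC.
(* After a transposition [<E, F F>] is the form of [E] at [F], so the one-sided bound [Ele]
   suffices. *)
have hEH : frob E H <= 4 * g ^+ 2 * frob F F.
  rewrite /H -(frob_sym Fs) -frob_tr trmx_mul Es Fs frobC; exact: Ele.
have hG : frob G G <= 16 * g ^+ 2 * frob F F.
  apply: le_trans (frob_le2 _ _) _.
  rewrite -[frob (F *m U) _]frob_tr trmx_mul Us Fs.
  have := Uop F; lra.
have hH := Fop F; rewrite -/H in hH.
have hL := frob_anticomm_ge.
clearbody G H F E.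
have hW := frob_le2 (eta ^+ 2 *: H) (- (eta *: G)).
rewrite frob_sqrD; move: hW.
move: (frob_ge0 F).
set l := frob F F in hEG hEH hG hH hL *; set W := frob (_ - _) (_ - _).
rewrite !frob_lin hEG => l0 hW.
have l1 : 0 <= eta * l by rewrite mulr_ge0 // ltW.
pose s := eta * g ^+ 2; have s1 : 2000 * s <= 1 := eta_g2.
have s0 : 0 <= s by rewrite mulr_ge0 ?sqr_ge0 // ltW.
have k1 : eta ^+ 2 * frob E H <= 4 * s * (eta * l).
  have := ler_wpM2l (sqr_ge0 eta) hEH; rewrite /s; lra.
have k2 : eta ^+ 2 * frob G G <= 16 * s * (eta * l).
  have := ler_wpM2l (sqr_ge0 eta) hG; rewrite /s; lra.
have k3 : eta ^+ 4 * frob H H <= 544 * s ^+ 3 * (eta * l).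
  have e4 : 0 <= eta ^+ 4 by rewrite exprn_ge0 // ltW.
  have := ler_wpM2l e4 hH; rewrite /s; lra.
have k4 : s * (eta * l) <= 1 / 2000 * (eta * l) by rewrite ler_wpM2r //; lra.
have k5 : s ^+ 3 * (eta * l) <= 1 / 2000 * (eta * l).
  apply: le_trans k4; rewrite ler_wpM2r //.
  by rewrite exprS ler_piMr // exprn_ile1 //; lra.
have k6 := ler_wpM2l (ltW eta0) hL.
lra.
Qed.

End GradientStep.

(** * From [opnorm2] and [sigma_min] to form bounds *)

Section SpectralBounds.
Variables (R : realType) (n : nat).
Implicit Types A : 'M[R]_n.

(** Cauchy-Schwarz on each row of [A]. *)
Lemma op_le_frob A : op_le A (frob A A).
Proof.
apply: op_le_col => x; rewrite -[frob A A]frob_tr (frob_col A^T) mulr_suml.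
rewrite frobE big_ord1; apply: ler_sum => i _.
have -> : (A *m x) i 0 = frob (col i A^T) x.
  by rewrite mxE frobE big_ord1; apply: eq_bigr => j _; rewrite !mxE.
exact: frob_CS.
Qed.

Lemma norm2_sqr (x : 'cV[R]_n) : norm2 x ^+ 2 = frob x x.
Proof. by rewrite norm2E sqr_sqrtr // frob_ge0. Qed.

Lemma norm2_ge0 (x : 'cV[R]_n) : 0 <= norm2 x.
Proof. exact: sqrtr_ge0. Qed.

Lemma norm2_le_opnorm2 A (x : 'cV[R]_n) : norm2 x <= 1 -> norm2 (A *m x) <= opnorm2 A.
Proof.
move=> x1; apply: ub_le_sup; last by exists x.
(* The Frobenius norm bounds the set, so [sup] is a true supremum and not a default value. *)
exists (Num.sqrt (frob A A)) => _ [y y1 <-].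
rewrite norm2E ler_wsqrtr // (le_trans (op_le_frob _ _)) // ler_piMr ?frob_ge0 //.
by rewrite -norm2_sqr exprn_ile1 // norm2_ge0.
Qed.

Lemma opnorm2_ge0 A : 0 <= opnorm2 A.
Proof.
apply: le_trans (norm2_ge0 (A *m 0)) (norm2_le_opnorm2 _ _).
by rewrite -(@ler_pXn2r _ 2) ?nnegrE ?norm2_ge0 // norm2_sqr /frob mulmx0 mxtrace0 expr1n ler01.
Qed.

Lemma op_le_opnorm2 A : op_le A (opnorm2 A ^+ 2).
Proof.
apply: op_le_col => x; have [->|x0] := eqVneq x 0.
  by rewrite /frob !mulmx0 mxtrace0 mulr0.
have N0 : norm2 x != 0.
  by apply: contraTneq (frob_gt0 x0) => N0; rewrite -norm2_sqr N0 expr0n ltxx.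
have /(@norm2_le_opnorm2 A) : norm2 ((norm2 x)^-1 *: x) <= 1.
  rewrite -(@ler_pXn2r _ 2) ?nnegrE ?norm2_ge0 // norm2_sqr !frob_lin -norm2_sqr.
  by rewrite expr1n mulrA -expr2 -exprMn mulVf // expr1n.
rewrite -(@ler_pXn2r _ 2) ?nnegrE ?norm2_ge0 ?opnorm2_ge0 // norm2_sqr.
rewrite -scalemxAr !frob_lin mulrA -expr2 exprVn norm2_sqr mulrC.
by rewrite ler_pdivrMr // frob_gt0.
Qed.

Lemma sigma_min_ge0 A : 0 <= sigma_min A.
Proof.
rewrite /sigma_min; have [->|/set0P S0] := eqVneq (singular_values A) set0.
  by rewrite inf0.
by apply: lb_le_inf => // s [].
Qed.

(* The largest a with a <= A is an eigenvalue: were A - a invertible, its form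
   would be bounded below by a positive constant and a could be increased. *)
Lemma form_ge_sigma_min A : A^T = A -> form_ge A 0 -> form_ge A (sigma_min A).
Proof.
move=> As A0; pose S : set R := fun a => form_ge A a.
apply: form_ge_col => x; have [->|x0] := eqVneq x 0.
  by rewrite /frob !mulmx0 mxtrace0 mulr0.
have S0 : S 0 by [].
have Sub : has_ubound S.
  exists (frob x (A *m x) / frob x x) => a Sa.
  by rewrite ler_pdivlMr ?frob_gt0.
have m0 : 0 <= sup S by exact: ub_le_sup.
(* The supremum is attained: a violation at [y] would put the Rayleigh quotient of [y] below some
   element of [S]. *)
have Sm : form_ge A (sup S).
  apply: form_ge_col => y; rewrite leNgt; apply/negP => hy.
  have y0 : y != 0.
    by apply: contraTneq hy => ->; rewrite /frob !mulmx0 mxtrace0 mulr0 ltxx.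
  rewrite -ltr_pdivrMr ?frob_gt0 // in hy.
  have [|a Sa] := sup_gt _ hy; first by exists 0.
  by rewrite ltr_pdivrMr ?frob_gt0 // ltNge Sa.
pose B := A - (sup S)%:M.
have Bs : B^T = B by rewrite /B linearB /= As tr_scalar_mx.
have BE k (X : 'M_(n, k)) : frob X (B *m X) = frob X (A *m X) - sup S * frob X X.
  by rewrite /B mulmxBl mul_scalar_mx !frob_lin.
have B0 : form_ge B 0 by move=> k X; rewrite mul0r BE subr_ge0.
(* A nonnegative eigenvalue of the symmetric [A] is a singular value, hence at least
   [sigma_min A]. *)
suff /eigenvalueP[v vA v0] : eigenvalue A (sup S).
  apply: (form_ge_weaken _ Sm); apply: ge_inf; first by exists 0 => s [].
  split=> //; apply/eigenvalueP; exists v => //.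
  by rewrite As mulmxA vA -scalemxAl vA scalerA -expr2.
rewrite /eigenvalue /eigenspace kermx_eq0 row_free_unit; apply/negP => Bu.
pose c := frob (invmx B) (invmx B) + 1; pose d := frob B B + 1.
have c0 : 0 < c by rewrite ltr_wpDl ?frob_ge0.
have d0 : 0 < d by rewrite ltr_wpDl ?frob_ge0.
have Bd : form_le B d.
  apply: op_le_form_le; first exact: ltW.
  move=> k X; apply: le_trans (op_le_frob _ _) _; rewrite ler_wpM2r ?frob_ge0 //.
  by rewrite /d; have := frob_ge0 B; nra.
(* [|X|^2 <= c |B X|^2] and [|B X|^2 <= d <X, B X>] give [B >= 1/(c d)], which exceeds the
   supremum. *)
suff /(ub_le_sup Sub) : S (sup S + (c * d)^-1).
  by rewrite gerDl leNgt invr_gt0 mulr_gt0.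
move=> k X; rewrite mulrDl -lerBrDl -BE mulrC ler_pdivrMr ?mulr_gt0 //.
have := op_le_frob (invmx B) (B *m X); rewrite mulKmx // => h1.
have h2 := psd_sqr_le X Bs d0 B0 Bd.
have h3 := frob_ge0 (B *m X).
apply: (@le_trans _ _ (c * frob (B *m X) (B *m X))); first by rewrite /c; lra.
by rewrite [leRHS]mulrC -mulrA ler_pM2l.
Qed.

End SpectralBounds.

(** * Positive definiteness and form bounds *)

Lemma symmetricmx_tr (R : realType) n (A : 'M[R]_n) :
  (A \is symmetricmx) = (A^T == A).
Proof. by rewrite qualifE /= expr0 scale1r map_mx_id // eq_sym. Qed.

Lemma posdef_form_ge0 (R : realType) n (A : 'M[R]_n) :
  posdef A -> A^T = A /\ form_ge A 0.
Proof.
move=> [+ Apos]; rewrite symmetricmx_tr => /eqP As; split=> //.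
apply: form_ge_col => x; rewrite mul0r; have [->|x0] := eqVneq x 0.
  by rewrite /frob !mulmx0 mxtrace0.
by rewrite -frob_quad ltW // Apos.
Qed.

Lemma form_ge_posdef (R : realType) n (A : 'M[R]_n) a :
  A^T = A -> 0 < a -> form_ge A a -> posdef A.
Proof.
move=> As a0 Aa; split=> [|x x0]; first by rewrite symmetricmx_tr As.
by rewrite frob_quad (lt_le_trans _ (Aa _ x)) // mulr_gt0 // frob_gt0.
Qed.

(** * Convergence, by induction on the steps *)

Theorem theorem3p2 (R : realType) :
  exists c chat : R,
    [/\ 0 < c, 0 < chat &
      forall (n : nat) (M U0 : 'M[R]_n),
        posdef M -> posdef U0 ->
        let beta : R :=
          Num.min (sigma_min U0) (Num.sqrt (sigma_min M)) in
        let alpha : R :=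
          (Num.max (opnorm2 U0) (Num.sqrt (opnorm2 M)) /
           Num.min (sigma_min U0) (Num.sqrt (sigma_min M))) ^+ 3 in
        forall (eta : R) (T : nat) (U : nat -> 'M[R]_n),
          0 < eta -> eta < c / (alpha * beta ^+ 2) ->
          (1 <= T)%N ->
          U 0%N = U0 ->
          (forall t : nat, (t < T)%N ->
             U t.+1 = U t - eta *: ((U t ^+ 2 - M) *m U t)
                          - eta *: (U t *m (U t ^+ 2 - M))) ->
          forall t : nat, (t < T)%N ->
            posdef (U t) /\
            normF (M - U t ^+ 2)
              <= expR (- (chat * eta * beta ^+ 2 * t%:R)) * normF (M - U0 ^+ 2)].
Proof.
(* The squared residual contracts at rate [eta b^2], the residual itself at half of it. *)
exists (1 / 2000), (1 / 2); split; [lra | lra |].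
case=> [|n] M U0 Mpos U0pos b a eta T U eta0 eta_lt _ U_0 US t tT.
  split.
    split=> [|x]; first by rewrite symmetricmx_tr !flatmx0.
    by rewrite [x]flatmx0 eqxx.
  by rewrite [M - _]flatmx0 normFE /frob mulmx0 mxtrace0 sqrtr0 mulr_ge0 ?expR_ge0 ?sqrtr_ge0.
have [Ms M0] := posdef_form_ge0 Mpos; have [U0s U00] := posdef_form_ge0 U0pos.
pose g := Num.max (opnorm2 U0) (Num.sqrt (opnorm2 M)).
have aE : a = (g / b) ^+ 3 by [].
have bU : b <= sigma_min U0 by rewrite /b ge_min lexx.
have bM : b <= Num.sqrt (sigma_min M) by rewrite /b ge_min lexx orbT.
have gU : opnorm2 U0 <= g by rewrite /g le_max lexx.
have gM : Num.sqrt (opnorm2 M) <= g by rewrite /g le_max lexx orbT.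
have b_ge0 : 0 <= b by rewrite /b le_min sigma_min_ge0 sqrtr_ge0.
have g_ge0 : 0 <= g by exact: le_trans (opnorm2_ge0 _) gU.
(* Were [b] zero, the bound on [eta] would be 0, as the inverse of 0 is 0. *)
have b0 : 0 < b.
  rewrite lt_def b_ge0 andbT; apply: contraTneq eta_lt => ->.
  by rewrite expr0n /= mulr0 invr0 mulr0 -leNgt ltW.
clearbody b a g.
have bh : b / 2 <= b by rewrite ler_pdivrMr ?ltr0n // ler_peMr // ler1n.
have gh : g <= 2 * g by rewrite ler_peMl // ler1n.
have bM2 : b ^+ 2 <= sigma_min M.
  by rewrite -[leRHS]sqr_sqrtr ?sigma_min_ge0 // lerXn2r ?nnegrE ?sqrtr_ge0.
have gM2 : opnorm2 M <= g ^+ 2.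
  by rewrite -[leLHS]sqr_sqrtr ?opnorm2_ge0 // lerXn2r ?nnegrE ?sqrtr_ge0.
have U0ge : form_ge U0 b := form_ge_weaken bU (form_ge_sigma_min U0s U00).
have Mge : form_ge M (b ^+ 2) := form_ge_weaken bM2 (form_ge_sigma_min Ms M0).
have U0le : form_le U0 g.
  apply: op_le_form_le => // k X; apply: le_trans (op_le_opnorm2 _ _) _.
  by rewrite ler_wpM2r ?frob_ge0 // lerXn2r ?nnegrE ?opnorm2_ge0.
have Mop : op_le M ((g ^+ 2) ^+ 2).
  move=> k X; apply: le_trans (op_le_opnorm2 _ _) _.
  by rewrite ler_wpM2r ?frob_ge0 // lerXn2r ?nnegrE ?opnorm2_ge0 ?sqr_ge0.
have bg : b <= g.
  (* Any nonzero vector compares the lower and upper bounds of [U0]; the dimension is positive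
     here. *)
  pose x : 'cV[R]_n.+1 := const_mx 1; have x0 : x != 0.
    by apply/eqP => /matrixP/(_ 0 0)/eqP; rewrite !mxE oner_eq0.
  by rewrite -(ler_pM2r (frob_gt0 x0)); exact: le_trans (U0ge _ x) (U0le _ x).
have g0 : 0 < g := lt_le_trans b0 bg.
have Msqr k (X : 'M_(n.+1, k)) :
    frob (M *m X) (M *m X) <= g ^+ 2 * frob X (M *m X).
  apply: psd_sqr_le => //; first by rewrite exprn_gt0.
  by apply: op_le_form_le => //; rewrite sqr_ge0.
(* [alpha beta^2] equals [g^3 / b]. *)
have eta_g3 : 2000 * (eta * g ^+ 3) <= b.
  move: eta_lt; rewrite aE.
  have -> : 1 / 2000 / ((g / b) ^+ 3 * b ^+ 2) = 1 / 2000 * b / g ^+ 3.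
    by field; rewrite !gt_eqF.
  rewrite ltr_pdivlMr ?exprn_gt0 //; lra.
have eta_g2 : 2000 * (eta * g ^+ 2) <= 1.
  rewrite -(ler_pM2r g0) mul1r; apply: le_trans bg; lra.
rewrite -exprM in Mop.
(* [U0] satisfies [b <= U0 <= g]; the factors 1/2 and 2 are the slack that makes the bounds
   invariant. *)
have inv s : (s < T)%N -> [/\ (U s)^T = U s, form_ge (U s) (b / 2),
    form_le (U s) (2 * g) &
    frob (U s *m U s - M) (U s *m U s - M)
      <= expR (- (eta * b ^+ 2 * s%:R)) * frob (U0 *m U0 - M) (U0 *m U0 - M)].
  elim: s => [_|s IH sT].
    rewrite U_0 mulr0 oppr0 expR0 mul1r; split=> //.
      by apply: form_ge_weaken U0ge.
    by move=> k X; apply: le_trans (U0le _ X) _; rewrite ler_wpM2r ?frob_ge0.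
  have [Uss Usge Usle Usn] := IH (ltnW sT).
  have -> : U s.+1 = gd_step M (U s) eta by rewrite US ?(ltnW sT) // /gd_step expr2 mulmxE.
  split.
  - exact: gd_step_sym.
  - exact: gd_step_ge Ms Uss eta0 b0 bg eta_g2 eta_g3 Mge Msqr Usge Usle.
  - exact: gd_step_le Ms Uss eta0 b0 bg eta_g2 Mge Mop Msqr Usge Usle.
  have := residual_gd_step_le Ms Uss eta0 b0 bg eta_g2 Mge Mop Usge Usle.
  move=> /le_trans; apply.
  have -> : - (eta * b ^+ 2 * s.+1%:R)
      = - (eta * b ^+ 2) + - (eta * b ^+ 2 * s%:R) by rewrite -natr1; ring.
  rewrite expRD -mulrA.
  apply: le_trans (ler_wpM2l (expR_ge0 _) Usn).
  (* [1 + x <= exp x] at [x = - eta b^2]. *)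
  by rewrite ler_wpM2r ?frob_ge0 // expR_ge1Dx.
have [Uts Utge _ Utn] := inv t tT; split.
  by apply: form_ge_posdef Utge => //; rewrite divr_gt0.
have normE V : normF (M - V ^+ 2) = Num.sqrt (frob (V *m V - M) (V *m V - M)).
  by rewrite normFE -opprB frobNl frobNr opprK expr2.
(* Writing the exponential as the root of its square doubles its rate to that of the squared
   residual. *)
rewrite !normE -[expR _]ger0_norm ?expR_ge0 // -sqrtr_sqr -sqrtrM ?sqr_ge0 //.
rewrite ler_wsqrtr // expr2 -expRD; apply: le_trans Utn _.
by rewrite (_ : - _ + - _ = - (eta * b ^+ 2 * t%:R)) //; field.
Qed.
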